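(* Let $(V,p,e)$ be a hyperbolic system of degree $n$ and let $\{c_1,c_2,\ldots,c_k\}\subseteq\Lambda_+$. If $\{c_1,\ldots,c_k\}$ is a Jordan frame, then it is orthonormal (that is, $\langle c_i,c_j\rangle=0$ for $i\ne j$ and $\langle c_i,c_i\rangle=1$ for all $i$) and $k=n$. The converse holds when the system is complete and each $c_i$ is a primitive idempotent: in that case, if $\{c_1,\ldots,c_k\}$ is orthonormal and $k=n$, then it is a Jordan frame.
   Context: Let $V$ be a finite-dimensional real vector space and $e\in V$ nonzero. A homogeneous polynomial $p$ of degree $n$ on $V$ is hyperbolic in the direction $e$ if $p(e)\ne 0$ and for every $x\in V$ the univariate polynomial $t\mapsto p(te-x)$ has only real zeros; then $(V,p,e)$ is called a hyperbolic system of degree $n$. Standing assumption: $n\ge 2$. The eigenvalue map $\lambda:V\to\mathbb{R}^n$ sends $x$ to the vector of roots of $t\mapsto p(te-x)$, with multiplicity, in decreasing order. The system is complete if $\lambda(x)=0$ implies $x=0$. The hyperbolicity cone is $\Lambda_+=\{x\in V:\lambda(x)\ge 0\}$ (entrywise). The semi-inner product on $V$ is $\langle x,y\rangle=\frac14\big[\|\lambda(x+y)\|^2-\|\lambda(x-y)\|^2\big]$ with the Euclidean norm on $\mathbb{R}^n$ (it is known that this is bilinear with $\langle x,x\rangle=\|\lambda(x)\|^2\ge 0$). An element $c$ is a primitive idempotent if $\lambda(c)=(1,0,\ldots,0)^T$. A Jordan frame in $(V,p,e)$ is a finite family $c_1,\ldots,c_k$ of primitive idempotents with $c_1+\cdots+c_k=e$.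 *)

(* Defs.v *)
From HB Require Import structures.
From mathcomp Require Import all_boot all_order all_algebra.
From mathcomp Require Import reals.
From mathcomp Require Import complex polyrcf mpoly.

Set Implicit Arguments.
Unset Strict Implicit.
Unset Printing Implicit Defensive.

Import Order.TTheory GRing.Theory Num.Theory.

Local Open Scope ring_scope.

(* A polynomial on V is given by its expression in the coordinates with respect
   to the fixed basis vbasis {:V}. *)
Definition polyOn (R : realType) (V : vectType R) := {mpoly R[\dim {:V}]}.

Section Hyperbolic.
Variables (R : realType) (V : vectType R).
Implicit Types (p : polyOn V) (e x y : V) (n k : nat).

Definition crd (i : 'I_(\dim {:V})) (x : V) : R := coord (vbasis {:V}) i x.

Definition pevalOn p x : R := p.@[fun i => crd i x].

(* The univariate polynomial t |-> p (t e - x); see horner_char_polyOn. *)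
Definition char_polyOn p e x : {poly R} :=
  mmap (@polyC R) (fun i => crd i e *: 'X - (crd i x)%:P) p.

Lemma horner_char_polyOn p e x t :
  (char_polyOn p e x).[t] = pevalOn p (t *: e - x).
Proof.
rewrite /char_polyOn /pevalOn /meval /mmap horner_sum; apply: eq_bigr => m _.
rewrite hornerM hornerC /mmap1 horner_prod; congr (_ * _).
apply: eq_bigr => i _; rewrite horner_exp !hornerE /crd linearB linearZ /=.
by rewrite mulrC.
Qed.

Definition only_real_zeros (u : {poly R}) : Prop :=
  forall z : R[i], root (map_poly (real_complex R) u) z -> complex.Im z = 0.

Definition hyperbolic_system p e n : Prop :=
  [/\ e != 0, p \is n.-homog for mdeg, pevalOn p e != 0 &
      forall x, only_real_zeros (char_polyOn p e x)].

(* rootsR lists the distinct roots in increasing order. *)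
Definition eigenvalue_seq p e x : seq R :=
  let u := char_polyOn p e x in
  rev (flatten [seq nseq (mup a u) a | a <- rootsR u]).

(* The default value 0 is never reached for a hyperbolic system of degree n:
   eigenvalue_seq p e x then has exactly n entries. *)
Definition eigenvalues p e n x : 'cV[R]_n :=
  \col_(i < n) nth 0 (eigenvalue_seq p e x) i.

(* The norm carried by matrices in MathComp-Analysis is the sup norm. *)
Definition enorm n (v : 'cV[R]_n) : R := Num.sqrt (\sum_i v i 0 ^+ 2).

Definition complete_system p e n : Prop :=
  forall x, eigenvalues p e n x = 0 -> x = 0.

Definition hyperbolicity_cone p e n x : Prop :=
  forall i, 0 <= eigenvalues p e n x i 0.

Definition sdot p e n x y : R :=
  4%:R^-1 * (enorm (eigenvalues p e n (x + y)) ^+ 2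
             - enorm (eigenvalues p e n (x - y)) ^+ 2).

Definition primitive_idempotent p e n c : Prop :=
  eigenvalues p e n c = \col_(i < n) (i == 0%N :> nat)%:R.

Definition jordan_frame p e n k (c : 'I_k -> V) : Prop :=
  (forall i, primitive_idempotent p e n (c i)) /\ \sum_i c i = e.

Definition orthonormal_family p e n k (c : 'I_k -> V) : Prop :=
  (forall i j, i != j -> sdot p e n (c i) (c j) = 0) /\
  (forall i, sdot p e n (c i) (c i) = 1).

End Hyperbolic.

(* Main.v *)
Require Import Defs.
From mathcomp Require Import all_boot all_order all_algebra.
From mathcomp Require Import reals.
From mathcomp Require Import complex polyrcf mpoly ring lra zify.

Set Implicit Arguments.
Unset Strict Implicit.
Unset Printing Implicit Defensive.

Import Order.TTheory GRing.Theory Num.Theory.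
Local Open Scope ring_scope.

(** Write lam_i(x) for the eigenvalues of x, so that p(t e - x) is p(e) times
    the product of the t - lam_i(x), and tr for their sum.  By homogeneity
    p(e - w x) is p(e) times the product of the 1 - w lam_i(x); hence the
    power sums of the eigenvalues are polynomials in the Taylor coefficients of
    p at e in the direction x.  For the second power sum this gives a
    quadratic form in x, so sdot is a symmetric bilinear form with
    sdot x x = sum of the lam_i(x)^2, and translating x by multiples of e gives
    sdot x e = tr x.

    The converse is then linear algebra: if s is the sum of n orthonormal
    primitive idempotents, |s - e|^2 = n - 2n + n = 0, so s - e has only zero
    eigenvalues and completeness gives s = e.

    For a Jordan frame, k = n follows by taking traces, and for fixed i the
    numbers sdot (c_j) (c_i) sum to sdot e (c_i) = tr (c_i) = 1, while the
    term j = i is already 1.  So orthogonality follows once any two primitive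
    idempotents c, d satisfy sdot c d >= 0 (primitive_sdot_ge0).

    The central step is that s |-> p(x - s c) is affine for c primitive
    (primitive_affine).  Along c + u x the quantity F(u), the sum of
    lam_i^2 lam_j^2 over ordered pairs of distinct indices, is a nonnegative
    polynomial in u that vanishes at 0, hence it is O(u^2).  One eigenvalue
    stays away from 0 because the sum of the lam_i^2 tends to 1, so all the
    others are O(u) and p(c + u x) = p(e) prod_i lam_i = O(u^(n-1)).  This
    bounds the order of vanishing of a polynomial in u whose coefficients, read
    backwards, are those of s |-> p(x + s c).

    Consequently r, s |-> p(e - r c - s d) is affine in each variable, and
    p(e - w (c + d)) = p(e) (1 - 2 w + D w^2) for some D.  This polynomial in
    w is a product of real factors 1 - lam_i w, which forces D <= 1, and
    comparing coefficients sdot c d = 1 - D. *)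

(** * Univariate real polynomials *)

Section Univariate.
Variable R : realFieldType.
Implicit Types P Q f : {poly R}.

Lemma poly_eq_off0 P Q : (forall t, t != 0 -> P.[t] = Q.[t]) -> P = Q.
Proof.
move=> PQ; apply/eqP; rewrite -subr_eq0; apply/eqP.
pose rs : seq R := [seq i.+1%:R | i <- iota 0 (size (P - Q))].
apply: (@roots_geq_poly_eq0 _ _ rs); last by rewrite size_map size_iota.
- apply/allP => _ /mapP[i _ ->]; rewrite /root hornerD hornerN PQ ?subrr //.
  by rewrite pnatr_eq0.
- by rewrite map_inj_uniq ?iota_uniq // => i j /eqP; rewrite eqr_nat => /eqP[].
Qed.

Lemma poly_unit_ball_bound P :
  exists2 C : R, 0 <= C & forall t : R, `|t| <= 1 -> `|P.[t]| <= C.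
Proof.
elim/poly_ind: P => [|P c [C C0 HC]].
  by exists 0 => // t _; rewrite horner0 normr0.
exists (C + `|c|) => [|t t1]; first by rewrite addr_ge0.
rewrite hornerMXaddC (le_trans (ler_normD _ _)) // lerD2r normrM.
by rewrite -[C]mulr1 ler_pM // HC.
Qed.

Lemma poly_MX P : P.[0] = 0 -> exists Q, P = Q * 'X.
Proof.
move=> P0; have : root P 0 by rewrite /root P0.
by case/factor_theorem => Q ->; exists Q; rewrite subr0.
Qed.

(** The form in which limits as t tends to 0 from the right are taken below. *)
Lemma small_linear_eq0 (a C d : R) :
  0 < d -> (forall t, 0 < t -> t <= d -> `|a| <= C * t) -> a = 0.
Proof.
move=> d0 H; apply/eqP; rewrite -normr_le0 leNgt; apply/negP => y0.
have C0 : 0 <= C.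
  by have := le_trans (normr_ge0 a) (H d d0 (lexx d)); rewrite pmulr_lge0.
have C1 : 0 < C + 1 by lra.
(* At t <= q the bound C * t is at most half of `|a|. *)
pose q := `|a| / (C + 1) / 2; pose t := Num.min d q.
have q0 : 0 < q by rewrite !divr_gt0.
have t0 : 0 < t by rewrite lt_min d0.
have td : t <= d by rewrite ge_min lexx.
have tq : t <= q by rewrite ge_min lexx orbT.
have qE : q * (C + 1) = `|a| / 2 by rewrite /q; field; rewrite lt0r_neq0.
have := H t t0 td; have : C * t <= C * q by rewrite ler_wpM2l.
move: qE y0 q0; rewrite mulrDr mulr1 mulrC; lra.
Qed.

(** Letting t tend to 0 shows that the constant coefficient is 0, and the
    quotient by 'X satisfies the same hypothesis with m - 1. *)
Lemma coef_vanishing_order m P (C d : R) : 0 < d ->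
  (forall t, 0 < t -> t <= d -> `|P.[t]| <= C * t ^+ m) ->
  forall j, (j < m)%N -> P`_j = 0.
Proof.
elim: m P d => // m IH P d; wlog d1 : d / d <= 1.
  move=> W d0 H; apply: (W (Num.min d 1)); first by rewrite ge_min lexx orbT.
    by rewrite lt_min d0 ltr01.
  by move=> t t0; rewrite le_min => /andP[td _]; apply: H.
move=> d0 H.
have [B B0 HB] := poly_unit_ball_bound P^`().
have C0 : 0 <= C.
  have := le_trans (normr_ge0 _) (H d d0 (lexx d)).
  by rewrite pmulr_lge0 // exprn_gt0.
have P0 : P.[0] = 0.
  have [Q PQ] : exists Q, P = Q * 'X + P.[0]%:P.
    have [|Q PQ] := @poly_MX (P - P.[0]%:P).
      by rewrite hornerD hornerN hornerC subrr.
    by exists Q; rewrite -PQ subrK.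
  have [D D0 HD] := poly_unit_ball_bound Q.
  apply: (@small_linear_eq0 _ (C + D) d d0) => t t0 td.
  have -> : P.[0] = P.[t] - Q.[t] * t by rewrite {2}PQ !hornerE; ring.
  rewrite (le_trans (ler_normB _ _)) // mulrDl lerD //.
    rewrite (le_trans (H t t0 td)) // ler_wpM2l // exprS.
    by apply: ler_piMr; rewrite ?exprn_ile1 ?(ltW t0) // (le_trans td).
  rewrite normrM (gtr0_norm t0) ler_wpM2r ?(ltW t0) // HD // gtr0_norm //.
  exact: le_trans td d1.
have [Q PQ] := poly_MX P0; subst P => -[|j] jm.
  by rewrite coefMX.
rewrite coefMX /=; apply: (IH Q d d0) => // t t0 td.
have := H t t0 td; rewrite hornerM hornerX normrM (gtr0_norm t0) exprSr mulrA.
by rewrite ler_pM2r.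
Qed.

(** A nonnegative polynomial vanishing at 0 has a critical point there: a
    nonzero linear term would make it change sign. *)
Lemma nonneg_poly_quadratic_bound f :
  (forall t, 0 <= f.[t]) -> f.[0] = 0 ->
  exists2 C : R, 0 <= C & forall t : R, `|t| <= 1 -> f.[t] <= C * t ^+ 2.
Proof.
move=> f0 /poly_MX[g fg]; subst f.
have [Q gQ] : exists Q, g = Q * 'X + g.[0]%:P.
  have [|Q gQ] := @poly_MX (g - g.[0]%:P).
    by rewrite hornerD hornerN hornerC subrr.
  by exists Q; rewrite -gQ subrK.
have [D D0 HD] := poly_unit_ball_bound Q.
have g0 : g.[0] = 0.
  apply: (@small_linear_eq0 _ D 1) => // t t0 t1.
  have tn : `|t| <= 1 by rewrite gtr0_norm.
  have Hp := f0 t; have Hn := f0 (- t).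
  have := HD t tn; have := HD (- t); rewrite normrN => /(_ tn).
  move: Hp Hn; rewrite gQ !hornerE => Hp Hn.
  have Hp' : 0 <= Q.[t] * t + g.[0] by rewrite -(pmulr_lge0 _ t0).
  have Hn' : Q.[-t] * -t + g.[0] <= 0.
    by rewrite -oppr_ge0 -(pmulr_lge0 _ t0) mulNr -mulrN.
  rewrite !ler_norml => /andP[? ?] /andP[? ?]; apply/andP; split; nra.
exists D => // t t1.
have -> : (g * 'X).[t] = Q.[t] * t ^+ 2 by rewrite gQ g0 !hornerE.
rewrite ler_wpM2r ?sqr_ge0 //; exact: le_trans (ler_norm _) (HD t t1).
Qed.

End Univariate.

Section RealRooted.
Variable R : realType.
Implicit Types (u : {poly R}) (s : seq R).

Lemma real_zeros_split u : only_real_zeros u ->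
  exists s, u = lead_coef u *: \prod_(a <- s) ('X - a%:P).
Proof.
have [->|u0] := eqVneq u 0; first by exists [::]; rewrite lead_coef0 scale0r.
move=> ru; have [r Dr] := closed_field_poly_normal (map_poly (real_complex R) u).
exists [seq complex.Re z | z <- r].
apply: (map_inj_poly (@complexI R) (rmorph0 _)).
rewrite map_polyZ /= rmorph_prod /= big_map.
rewrite [LHS]Dr lead_coef_map /=; congr (_ *: _).
apply: eq_big_seq => z zr; rewrite rmorphB /= map_polyX map_polyC /=.
suff -> : z = real_complex R (complex.Re z) by [].
have : root (map_poly (real_complex R) u) z.
  by rewrite Dr rootZ ?root_prod_XsubC // lead_coef_map /= fmorph_eq0 lead_coef_eq0.
by move/ru; case: z {zr} => a b /= ->.
Qed.

Lemma count_flatten_nseq (s : seq R) (m : R -> nat) a : uniq s ->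
  count_mem a (flatten [seq nseq (m b) b | b <- s]) = ((a \in s) * m a)%N.
Proof.
elim: s => //= b s IH /andP[bs us].
rewrite count_cat count_nseq IH // in_cons /=.
have [->|ab] := eqVneq a b; first by rewrite (negbTE bs) mul0n addn0.
by [].
Qed.

(** Identifies the list from which eigenvalues are read, apart from its order,
    with the roots in any splitting of the polynomial. *)
Lemma perm_roots_with_mult c s u : c != 0 ->
  u = c *: \prod_(a <- s) ('X - a%:P) ->
  perm_eq (flatten [seq nseq (mup a u) a | a <- rootsR u]) s.
Proof.
move=> c0 uE; have u0 : u != 0.
  by rewrite uE scaler_eq0 negb_or c0 monic_neq0 // monic_prod_XsubC.
have mupE a : mup a u = count_mem a s.
  rewrite uE -mul_polyC mupMr ?mu_prod_XsubC //.
  by rewrite /root hornerC.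
apply/allP => a _ /=; rewrite count_flatten_nseq ?uniq_roots // mupE.
have := roots_on_rootsR u0 a; rewrite /= => <-.
rewrite uE rootZ // root_prod_XsubC.
by have [|/count_memPn->] := boolP (a \in s); rewrite ?mul1n ?muln0.
Qed.

End RealRooted.

Section Newton.
Variable R : comNzRingType.
Implicit Types (s : seq R) (P : {poly R}).

Definition rev_prod s : {poly R} := \prod_(a <- s) (1 - a *: 'X).

(** The coefficients of rev_prod s are the elementary symmetric functions up
    to sign, so these are Newton's identities.  Only the sums needed later are
    listed; adding one root a replaces c_k by c_k - a c_(k-1), and each identity
    is compatible with this. *)
Lemma newton_sums s (c := fun k => (rev_prod s)`_k) :
  [/\ c 0%N = 1,
      \sum_(a <- s) a = - c 1%N,
      \sum_(a <- s) a ^+ 2 = c 1%N ^+ 2 - c 2%N *+ 2 &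
      \sum_(a <- s) a ^+ 4 = c 1%N ^+ 4 - c 1%N ^+ 2 * c 2%N *+ 4
        + c 1%N * c 3%N *+ 4 + c 2%N ^+ 2 *+ 2 - c 4%N *+ 4].
Proof.
rewrite {}/c; elim: s => [|a s [c0 c1 c2 c4]].
  by rewrite /rev_prod !big_nil !coef1 /=; split=> //; ring.
have cS k : (rev_prod (a :: s))`_k.+1
    = (rev_prod s)`_k.+1 - a * (rev_prod s)`_k.
  by rewrite /rev_prod big_cons mulrBl mul1r -scalerAl coefB coefZ coefXM.
have cz : (rev_prod (a :: s))`_0 = (rev_prod s)`_0.
  by rewrite /rev_prod big_cons mulrBl mul1r -scalerAl coefB coefZ coefXM mulr0 subr0.
rewrite !big_cons c1 c2 c4 !cS cz c0; split=> //; ring.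
Qed.

End Newton.

(** * Restriction of a polynomial to lines *)

Section ChainRule.
Variables (R : comNzRingType) (d : nat) (h : 'I_d -> {poly R}).

Let along (p : {mpoly R[d]}) : {poly R} := mmap (@polyC R) h p.
Let chain p := (along p)^`() = \sum_i (h i)^`() * along p^`M(i).

(** Both sides obey the Leibniz rule in p, so it is enough to compare them on
    constants and on variables. *)
Lemma mmap_polyC_deriv p : chain p.
Proof.
have chainM p1 p2 : chain p1 -> chain p2 -> chain (p1 * p2).
  rewrite /chain /along rmorphM derivM => -> ->.
  rewrite mulr_suml mulr_sumr -big_split; apply: eq_bigr => i _ /=.
  by rewrite mderivM rmorphD !rmorphM /=; ring.
have chain1 : chain 1.
  rewrite /chain /along rmorph1 derivC big1 // => i _.
  by rewrite -mpolyC1 mderivC rmorph0 mulr0.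
have chainX m : chain 'X_[m].
  rewrite mpolyXE_id; apply: big_ind => // i _.
  elim: (m i) => [|k IH]; first by rewrite expr0.
  rewrite exprS; apply: chainM IH; rewrite /chain /along mmapX mmap1U.
  have UU : (U_(i) - U_(i) = 0 :> 'X_{1..d})%MM.
    by apply/mnmP => j; rewrite mnmBE mnm0E subnn.
  rewrite (bigD1 i) //= mderivX mnm1E eqxx scale1r UU mpolyX0 rmorph1 mulr1.
  rewrite big1 ?addr0 // => j ji.
  by rewrite mderivX mnm1E eq_sym (negbTE ji) scale0r rmorph0 mulr0.
elim/mpolyind: p => [|c m q _ _ IH]; rewrite /chain /along.
  by rewrite rmorph0 deriv0 big1 // => i _; rewrite mderiv0 rmorph0 mulr0.
rewrite rmorphD derivD -/(along q) IH -mul_mpolyC rmorphM /= mmapC.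
rewrite mul_polyC derivZ -/(along _) chainX -mul_polyC mulr_sumr -big_split.
apply: eq_bigr => i _ /=.
by rewrite mderivD mderiv_mulC rmorphD rmorphM /= mmapC; rewrite /along; ring.
Qed.

End ChainRule.

Section Lines.
Variables (R : realType) (V : vectType R).
Implicit Types (p : polyOn V) (x y z : V).

Definition line_poly p x y : {poly R} :=
  mmap (@polyC R) (fun i => (crd i x)%:P + crd i y *: 'X) p.

Lemma horner_line_poly p x y t : (line_poly p x y).[t] = pevalOn p (x + t *: y).
Proof.
rewrite /line_poly /pevalOn /meval /mmap horner_sum; apply: eq_bigr => m _.
rewrite hornerM hornerC /mmap1 horner_prod; congr (_ * _).
apply: eq_bigr => i _; rewrite horner_exp !hornerE /crd linearD linearZ /=.
by rewrite mulrC.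
Qed.

Lemma pevalOn_homog n p a x : p \is n.-homog for mdeg ->
  pevalOn p (a *: x) = a ^+ n * pevalOn p x.
Proof.
move=> /dhomogP hp; rewrite /pevalOn !mevalE mulr_sumr !big_seq.
apply: eq_bigr => m mp; rewrite -(hp m mp : mdeg m = n) mdegE.
rewrite mulrCA; congr (_ * _); rewrite expr_sum -big_split /=.
by apply: eq_bigr => i _; rewrite /crd linearZ exprMn.
Qed.

Lemma size_line_poly n p x y : p \is n.-homog for mdeg ->
  (size (line_poly p x y) <= n.+1)%N.
Proof.
move=> /dhomogP hp; rewrite /line_poly /mmap big_seq.
apply: (leq_trans (size_sum _ _ _)); apply/bigmax_leqP_seq => m _ mp.
rewrite -(hp m mp : mdeg m = n).
rewrite mul_polyC; apply: (leq_trans (size_scale_leq _ _)).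
rewrite /mmap1 /= mdegE.
pose K (P : {poly R}) k := (size P <= k.+1)%N.
apply: (big_ind2 K) => [|P1 k1 P2 k2 H1 H2|i _]; rewrite /K.
- by rewrite size_poly1.
- apply: leq_trans (size_polyMleq _ _) _.
  by move: H1 H2; rewrite /K; lia.
elim: (m i) => [|k IH]; first by rewrite expr0 size_poly1.
rewrite exprS; apply: leq_trans (size_polyMleq _ _) _.
suff : (size ((crd i x)%:P + crd i y *: 'X)%R <= 2)%N by lia.
rewrite (leq_trans (size_polyD _ _)) // geq_max.
rewrite (leq_trans (size_polyC_leq1 _)) //=.
by rewrite (leq_trans (size_scale_leq _ _)) // size_polyX.
Qed.

(** Both sides come from the binary form (a, b) |-> p (a x + b y), so they have
    the same coefficients in opposite order. *)
Lemma line_poly_rev n p x y : p \is n.-homog for mdeg ->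
  line_poly p x y = \poly_(j < n.+1) (line_poly p y x)`_(n - j).
Proof.
move=> hp; apply: poly_eq_off0 => t t0; rewrite horner_line_poly horner_poly.
have -> : x + t *: y = t *: (y + t^-1 *: x).
  by rewrite scalerDr scalerA divff // scale1r addrC.
rewrite (pevalOn_homog _ _ hp) -horner_line_poly.
rewrite (horner_coef_wide _ (size_line_poly y x hp)) mulr_sumr.
rewrite (reindex_inj rev_ord_inj); apply: eq_bigr => j _ /=.
have jn : (j <= n)%N by rewrite -ltnS.
rewrite subSS mulrCA; congr (_ * _).
rewrite exprVn; apply: (canLR (mulfK _)); first by rewrite expf_neq0.
by rewrite -exprD subnKC.
Qed.

Lemma deriv_line_poly p x y :
  (line_poly p x y)^`() = \sum_i crd i y *: line_poly p^`M(i) x y.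
Proof.
rewrite /line_poly mmap_polyC_deriv; apply: eq_bigr => i _.
by rewrite derivD derivC add0r derivZ derivX alg_polyC mul_polyC.
Qed.

(** Obtained from the polynomial p (x + w (y + u z)) in w with coefficients in
    R[u]. *)
Lemma coef_line_poly_poly p x y z k :
  exists P : {poly R}, forall u, P.[u] = (line_poly p x (y + u *: z))`_k.
Proof.
pose Q : {poly {poly R}} := mmap (fun c : R => c%:P%:P)
  (fun i => (crd i x)%:P%:P + ((crd i y)%:P + crd i z *: 'X) *: 'X) p.
exists Q`_k => u.
have -> : line_poly p x (y + u *: z) = map_poly (horner_eval u) Q.
  rewrite /Q /line_poly /mmap rmorph_sum; apply: eq_bigr => m _ /=.
  rewrite rmorphM /= map_polyC /= horner_evalE hornerC; congr (_ * _).
  rewrite /mmap1 rmorph_prod; apply: eq_bigr => i _ /=.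
  rewrite rmorphXn rmorphD /= map_polyC map_polyZ map_polyX /= !horner_evalE.
  by rewrite !hornerE /crd linearD linearZ /= [u * _]mulrC.
by rewrite coef_map.
Qed.

End Lines.

(** * Eigenvalues and the bilinear form *)

Section Spectrum.
Variables (R : realType) (V : vectType R) (p : polyOn V) (e : V) (n : nat).
Hypothesis hsys : hyperbolic_system p e n.
Implicit Types (x y z : V) (l : 'I_n -> R) (t u : R).

Local Notation p0 := (pevalOn p e).
Local Notation ev x := (fun i : 'I_n => eigenvalues p e n x i 0).

Let p0_neq0 : p0 != 0. Proof. by case: hsys. Qed.
Let p_homog : p \is n.-homog for mdeg. Proof. by case: hsys. Qed.

(** Any enumeration of the eigenvalues of x; no order is imposed, so that the
    spectrum of a translate of x is simply the translated family. *)
Definition spectrum x l :=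
  forall t, pevalOn p (t *: e - x) = pevalOn p e * \prod_i (t - l i).

(** The polynomial has degree exactly n with leading coefficient p e, and it
    splits because all its complex roots are real. *)
Lemma char_poly_factor x :
  char_polyOn p e x = p0 *: \prod_i ('X - (ev x i)%:P).
Proof.
have cE : char_polyOn p e x = line_poly p (- x) e.
  apply: poly_eq_off0 => t _.
  by rewrite horner_char_polyOn horner_line_poly addrC.
rewrite (line_poly_rev _ _ p_homog) in cE.
have cn : (char_polyOn p e x)`_n = p0.
  rewrite cE coef_poly ltnSn subnn -horner_coef0 horner_line_poly.
  by rewrite scale0r addr0.
have sc : size (char_polyOn p e x) = n.+1.
  apply/eqP; rewrite eqn_leq {1}cE size_poly ltnNge; apply/negP => sn.
  by move: p0_neq0; rewrite -cn nth_default ?eqxx.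
have lc : lead_coef (char_polyOn p e x) = p0 by rewrite /lead_coef sc.
have [s cs] : exists s, char_polyOn p e x = p0 *: \prod_(a <- s) ('X - a%:P).
  by rewrite -lc; apply: real_zeros_split; case: hsys.
have ps : perm_eq (eigenvalue_seq p e x) s.
  by rewrite perm_rev; apply: (perm_roots_with_mult p0_neq0).
have sz : size (eigenvalue_seq p e x) = n.
  rewrite (perm_size ps); apply/eqP; rewrite -eqSS -sc cs size_scale //.
  by rewrite size_prod_XsubC.
rewrite cs -(perm_big _ ps) /= (big_nth 0) sz big_mkord.
by congr (_ *: _); apply: eq_bigr => i _; rewrite mxE.
Qed.

Lemma spectrum_eigenvalues x : spectrum x (ev x).
Proof.
move=> t; rewrite -horner_char_polyOn char_poly_factor hornerZ horner_prod.
by congr (_ * _); apply: eq_bigr => i _; rewrite !hornerE.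
Qed.

Lemma line_poly_spectrum x l : spectrum x l ->
  line_poly p e (- x) = p0 *: rev_prod (codom l).
Proof.
move=> xl; apply: poly_eq_off0 => t t0.
rewrite horner_line_poly hornerZ /rev_prod horner_prod big_image /=.
have -> : e + t *: (- x) = t *: (t^-1 *: e - x).
  by rewrite scalerDr scalerA divff // scale1r scalerN.
rewrite (pevalOn_homog _ _ p_homog) xl mulrCA; congr (_ * _).
rewrite -[X in t ^+ X]card_ord -prodr_const -big_split /=.
by apply: eq_bigr => i _; rewrite mulrBr divff // !hornerE mulrC.
Qed.

(** The elementary symmetric functions of the eigenvalues, up to sign. *)
Definition char_coef x k := (line_poly p e (- x))`_k / p0.

Lemma char_coefE x l k : spectrum x l ->
  char_coef x k = (rev_prod (codom l))`_k.
Proof.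
by move=> xl; rewrite /char_coef (line_poly_spectrum xl) coefZ mulrC mulKf.
Qed.

Lemma spectrum_power_sums x l (c := char_coef x) : spectrum x l ->
  [/\ \sum_i l i = - c 1%N,
      \sum_i l i ^+ 2 = c 1%N ^+ 2 - c 2%N *+ 2 &
      \sum_i l i ^+ 4 = c 1%N ^+ 4 - c 1%N ^+ 2 * c 2%N *+ 4
        + c 1%N * c 3%N *+ 4 + c 2%N ^+ 2 *+ 2 - c 4%N *+ 4].
Proof.
move=> xl; rewrite /c !(char_coefE _ xl).
by have [_ <- <- <-] := newton_sums (codom l); rewrite !big_image.
Qed.

Definition trace x := \sum_i ev x i.
Definition sqnorm x := \sum_i ev x i ^+ 2.

Lemma traceE x l : spectrum x l -> trace x = \sum_i l i.
Proof.
move=> /spectrum_power_sums[-> _ _].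
by have [<- _ _] := spectrum_power_sums (spectrum_eigenvalues x).
Qed.

Lemma sqnormE x l : spectrum x l -> sqnorm x = \sum_i l i ^+ 2.
Proof.
move=> /spectrum_power_sums[_ -> _].
by have [_ <- _] := spectrum_power_sums (spectrum_eigenvalues x).
Qed.

Lemma spectrum_shift x l t : spectrum x l ->
  spectrum (x + t *: e) (fun i => l i + t).
Proof.
move=> xl s; rewrite opprD addrA addrAC -scalerBl xl.
by congr (_ * _); apply: eq_bigr => i _; ring.
Qed.

Lemma pevalOn_eigenvalues x : pevalOn p x = p0 * \prod_i ev x i.
Proof.
have := spectrum_eigenvalues x 0; rewrite scale0r add0r -scaleN1r.
rewrite (pevalOn_homog _ _ p_homog).
under [in RHS]eq_bigr do rewrite sub0r -mulN1r.
rewrite big_split /= prodr_const card_ord mulrCA => /mulfI -> //.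
by rewrite expf_neq0 // oppr_eq0 oner_eq0.
Qed.

Definition grad_form x := \sum_i crd i x * pevalOn p^`M(i) e.
Definition hess_form x y :=
  \sum_i crd i x * \sum_j crd j y * pevalOn p^`M(i)^`M(j) e.

(** The polarization of the sum of the squared eigenvalues; it is minus the
    second derivative of log |p| at e. *)
Definition trace_form x y :=
  grad_form x * grad_form y / p0 ^+ 2 - hess_form x y / p0.

Lemma char_coef1 x : char_coef x 1 = - grad_form x / p0.
Proof.
rewrite /char_coef; congr (_ / _).
have -> : (line_poly p e (- x))`_1 = (line_poly p e (- x))^`().[0].
  by rewrite horner_coef0 coef_deriv mulr1n.
rewrite deriv_line_poly horner_sum -sumrN; apply: eq_bigr => i _.
rewrite hornerZ horner_line_poly scale0r addr0.
by rewrite /crd linearN mulNr.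
Qed.

Lemma char_coef2 x : char_coef x 2 *+ 2 = hess_form x x / p0.
Proof.
rewrite /char_coef -mulrnAl; congr (_ / _).
have -> : (line_poly p e (- x))`_2 *+ 2 = (line_poly p e (- x))^`()^`().[0].
  by rewrite horner_coef0 !coef_deriv mulr1n.
rewrite deriv_line_poly linear_sum /= horner_sum; apply: eq_bigr => i _.
rewrite derivZ hornerZ deriv_line_poly horner_sum /crd linearN mulNr -mulrN.
rewrite -sumrN; congr (_ * _); apply: eq_bigr => j _.
by rewrite hornerZ horner_line_poly scale0r addr0 /crd linearN mulNr opprK.
Qed.

Lemma sqnorm_trace_form x : sqnorm x = trace_form x x.
Proof.
have [_ + _] := spectrum_power_sums (spectrum_eigenvalues x).
by rewrite /sqnorm => ->; rewrite char_coef1 char_coef2 /trace_form; field.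
Qed.

Lemma grad_formD t x y : grad_form (t *: x + y) = t * grad_form x + grad_form y.
Proof.
rewrite /grad_form mulr_sumr -big_split; apply: eq_bigr => i _ /=.
by rewrite /crd linearP /= mulrDl mulrA.
Qed.

Lemma hess_formDl t x y z :
  hess_form (t *: x + y) z = t * hess_form x z + hess_form y z.
Proof.
rewrite /hess_form mulr_sumr -big_split; apply: eq_bigr => i _ /=.
by rewrite /crd linearP /= mulrDl mulrA.
Qed.

Lemma hess_formDr t x y z :
  hess_form z (t *: x + y) = t * hess_form z x + hess_form z y.
Proof.
rewrite /hess_form mulr_sumr -big_split; apply: eq_bigr => i _ /=.
rewrite mulrCA -mulrDr; congr (_ * _).
rewrite mulr_sumr -big_split; apply: eq_bigr => j _ /=.
by rewrite /crd linearP /= mulrDl mulrA.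
Qed.

Local Notation sd := (sdot p e n).

Lemma sdotE x y : sd x y = 4^-1 * (sqnorm (x + y) - sqnorm (x - y)).
Proof.
by rewrite /sdot /enorm !sqr_sqrtr //; apply: sumr_ge0 => i _;
  rewrite sqr_ge0.
Qed.

Lemma sdot_trace_form x y : sd x y = (trace_form x y + trace_form y x) / 2.
Proof.
rewrite sdotE !sqnorm_trace_form /trace_form.
rewrite -[x + y](congr1 (+%R^~ y) (scale1r x)).
have -> : x - y = (-1) *: y + x by rewrite scaleN1r addrC.
by rewrite !(grad_formD, hess_formDl, hess_formDr); field.
Qed.

Lemma sdotC x y : sd x y = sd y x.
Proof. by rewrite !sdot_trace_form addrC. Qed.

Lemma sdotDl t x y z : sd (t *: x + y) z = t * sd x z + sd y z.
Proof.
rewrite !sdot_trace_form /trace_form.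
by rewrite !(grad_formD, hess_formDl, hess_formDr); field.
Qed.

Lemma sdot_suml k (c : 'I_k -> V) z : sd (\sum_i c i) z = \sum_i sd (c i) z.
Proof.
have sd0 : sd 0 z = 0.
  have := sdotDl 1 0 0 z; rewrite scale1r addr0 mul1r => /eqP.
  by rewrite -subr_eq0 opprD addrA subrr sub0r oppr_eq0 => /eqP.
apply: (big_morph (sd^~ z)) => // x y.
by have := sdotDl 1 x y z; rewrite scale1r mul1r.
Qed.

Lemma sdot_self x : sd x x = sqnorm x.
Proof. by rewrite sdot_trace_form sqnorm_trace_form; field. Qed.

(** Translation by e and by - e moves the eigenvalues by 1 and by - 1, and
    (l + 1)^2 - (l - 1)^2 = 4 l. *)
Lemma sdot_unit x : sd x e = trace x.
Proof.
have shift t := sqnormE (spectrum_shift t (spectrum_eigenvalues x)).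
rewrite sdotE; have -> : x + e = x + 1 *: e by rewrite scale1r.
have -> : x - e = x + (-1) *: e by rewrite scaleN1r.
rewrite !shift -sumrB mulr_sumr.
by apply: eq_bigr => i _; field.
Qed.

Lemma trace_unit : trace e = n%:R.
Proof.
rewrite (@traceE _ (fun=> 1)) ?sumr_const ?card_ord // => t.
rewrite -[X in _ - X]scale1r -scalerBl (pevalOn_homog _ _ p_homog) mulrC.
by rewrite prodr_const card_ord.
Qed.

End Spectrum.

(** * Primitive idempotents *)

Section PairSums.
Variables (R : realFieldType) (n : nat) (b : 'I_n -> R).
Hypothesis b0 : forall i, 0 <= b i.

Let pair_sumE :
  (\sum_i b i) ^+ 2 - \sum_i b i ^+ 2 = \sum_i b i * \sum_(j | j != i) b j.
Proof.
rewrite expr2 mulr_suml -sumrB; apply: eq_bigr => i _.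
by rewrite (bigD1 i) //=; ring.
Qed.

Lemma pair_sum_ge0 : 0 <= (\sum_i b i) ^+ 2 - \sum_i b i ^+ 2.
Proof.
by rewrite pair_sumE; apply: sumr_ge0 => i _; rewrite mulr_ge0 // sumr_ge0.
Qed.

Lemma le_pair_sum i j : j != i ->
  b i * b j <= (\sum_i b i) ^+ 2 - \sum_i b i ^+ 2.
Proof.
move=> ji; rewrite pair_sumE (bigD1 i) //= (bigD1 j) //= mulrDr -addrA.
rewrite lerDl addr_ge0 ?mulr_ge0 ?sumr_ge0 // => k _.
by rewrite mulr_ge0 // sumr_ge0.
Qed.

End PairSums.

Section RankOne.
Variables (R : realType) (V : vectType R) (p : polyOn V) (e : V) (n : nat).
Hypothesis n_gt0 : (0 < n)%N.
Hypothesis hsys : hyperbolic_system p e n.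
Implicit Types (c d x : V) (t u : R).

Local Notation p0 := (pevalOn p e).
Local Notation ev x i := (eigenvalues p e n x i 0).
Let p0_neq0 : p0 != 0. Proof. by case: hsys. Qed.
Let p_homog : p \is n.-homog for mdeg. Proof. by case: hsys. Qed.

Lemma primitive_ev c i : primitive_idempotent p e n c ->
  ev c i = (i == Ordinal n_gt0)%:R.
Proof. by move=> cP; rewrite cP mxE. Qed.

Lemma primitive_power_sum c k : primitive_idempotent p e n c ->
  \sum_i ev c i ^+ k.+1 = 1.
Proof.
move=> cP; rewrite (bigD1 (Ordinal n_gt0)) //= primitive_ev // eqxx expr1n.
rewrite big1 ?addr0 // => i /negbTE i0.
by rewrite primitive_ev // i0 expr0n.
Qed.

Lemma power_sum_polys c x : exists q2 q4 : {poly R},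
  forall u, \sum_i ev (c + u *: x) i ^+ 2 = q2.[u]
         /\ \sum_i ev (c + u *: x) i ^+ 4 = q4.[u].
Proof.
have cf k : exists P : {poly R}, forall u, char_coef p e (c + u *: x) k = P.[u].
  have [P PE] := coef_line_poly_poly p e (- c) (- x) k.
  exists (p0^-1 *: P) => u; rewrite hornerZ PE /char_coef mulrC.
  by rewrite opprD scalerN.
have [P1 E1] := cf 1%N; have [P2 E2] := cf 2%N.
have [P3 E3] := cf 3%N; have [P4 E4] := cf 4%N.
exists (P1 ^+ 2 - P2 *+ 2).
exists (P1 ^+ 4 - P1 ^+ 2 * P2 *+ 4 + P1 * P3 *+ 4 + P2 ^+ 2 *+ 2 - P4 *+ 4).
move=> u.
have [_ -> ->] :=
  spectrum_power_sums hsys (spectrum_eigenvalues hsys (c + u *: x)).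
rewrite E1 E2 E3 E4.
by rewrite !(hornerD, hornerN, hornerM, hornerMn, horner_exp).
Qed.

(** Eigenvalues of c + u x for small u > 0: one of them is bounded away from 0,
    and since every product of two of them is O(u), the n - 1 others are
    O(u). *)
Lemma primitive_small_det c x : primitive_idempotent p e n c ->
  exists C d : R, 0 < d /\
    forall u, 0 < u -> u <= d -> `|pevalOn p (c + u *: x)| <= C * u ^+ n.-1.
Proof.
move=> cP; have [q2 [q4 qE]] := power_sum_polys c x.
have q20 : q2.[0] = 1.
  by have [<- _] := qE 0; rewrite scale0r addr0 primitive_power_sum.
have q40 : q4.[0] = 1.
  by have [_ <-] := qE 0; rewrite scale0r addr0 primitive_power_sum.
have fE u : (q2 ^+ 2 - q4).[u] = (\sum_i ev (c + u *: x) i ^+ 2) ^+ 2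
    - \sum_i (ev (c + u *: x) i ^+ 2) ^+ 2.
  rewrite hornerD hornerN horner_exp; have [<- <-] := qE u.
  by congr (_ - _); apply: eq_bigr => i _; rewrite -exprM.
(* This difference is the sum of (l_i l_j)^2 over ordered pairs i <> j. *)
have [|| C C0 HC] := @nonneg_poly_quadratic_bound _ (q2 ^+ 2 - q4).
- by move=> u; rewrite fE pair_sum_ge0 // => i; rewrite sqr_ge0.
- by rewrite hornerD hornerN horner_exp q20 q40 expr1n subrr.
have [|g gE] := @poly_MX _ (q2 - 1).
  by rewrite hornerD hornerN hornerC q20 subrr.
have [D D0 HD] := poly_unit_ball_bound g.
pose nR : R := n%:R.
have nR1 : 1 <= nR by rewrite ler1n.
(* From 1/4 <= n (l_i)^2 and (l_i l_j)^2 <= C u^2 one gets (l_j)^2 <= 4 n C u^2,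
   and 4 n C <= M <= M^2. *)
pose M := 4 * nR * C + 1.
have M1 : 1 <= M by rewrite /M lerDr !mulr_ge0 // ler0n.
(* Makes |q2 - 1| <= D u <= 1/2 for u <= d. *)
pose d := (2 * (D + 1))^-1.
have d0 : 0 < d by rewrite invr_gt0; lra.
have dE : d * D + d = 1 / 2 by rewrite /d; field; lra.
exists (`|p0| * 2 * M ^+ n.-1), d; split=> // u u0 ud.
have u1 : `|u| <= 1 by rewrite gtr0_norm //; nra.
have [q2l q2u] : 1 / 2 <= q2.[u] /\ q2.[u] <= 2.
  have -> : q2.[u] = g.[u] * u + 1.
    by rewrite -hornerMX -gE hornerD hornerN hornerC subrK.
  have := HD u u1; rewrite ler_norml => /andP[gl gu].
  by split; nra.
have [q2E _] := qE u.
set l := eigenvalues p e n (c + u *: x) in q2E fE *.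
have [i li] : exists i, 1 / 4 <= nR * l i 0 ^+ 2.
  apply/existsP; apply: contraLR q2l => /existsPn H; rewrite -ltNge -q2E.
  suff : nR * (\sum_i l i 0 ^+ 2) <= nR * (1 / 4) by rewrite ler_pM2l; lra.
  have -> : nR * (1 / 4) = \sum_(i < n) (1 / 4 : R).
    by rewrite sumr_const card_ord mulr_natl.
  rewrite mulr_sumr; apply: ler_sum => i _.
  by have := H i; rewrite -ltNge => /ltW.
have lj j : j != i -> `|l j 0| <= M * u.
  move=> ji; rewrite -(ler_pXn2r (ltn0Sn 1)) ?nnegrE ?mulr_ge0 //; try lra.
  rewrite -normrX ger0_norm ?sqr_ge0 // exprMn.
  have := le_pair_sum (fun k => sqr_ge0 (l k 0)) ji.
  rewrite -fE; have := HC u u1.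
  have := sqr_ge0 (l j 0); have := sqr_ge0 (l i 0); have := sqr_ge0 u.
  move: li; set U := u ^+ 2; set a := l i 0 ^+ 2; set b := l j 0 ^+ 2.
  set F := (_).[u] => li U0 a0 b0 FC abF.
  have h1 : 0 <= b * (nR * a - 1 / 4) by rewrite mulr_ge0 // subr_ge0.
  have h2 : 0 <= nR * (C * U - a * b).
    by rewrite mulr_ge0 ?ler0n // subr_ge0; apply: le_trans FC.
  have h3 : 0 <= M * (M - 1) * U by rewrite !mulr_ge0 //; lra.
  have h4 : (M - 1) * U = 4 * nR * C * U by rewrite /M addrK.
  by nra.
have li2 : `|l i 0| <= 2.
  rewrite -(ler_pXn2r (ltn0Sn 1)) ?nnegrE // -normrX ger0_norm ?sqr_ge0 //.
  have : l i 0 ^+ 2 <= q2.[u].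
    by rewrite -q2E (bigD1 i) //= lerDl sumr_ge0 // => j _; rewrite sqr_ge0.
  by lra.
rewrite (pevalOn_eigenvalues hsys) normrM -!mulrA ler_wpM2l //.
rewrite (bigD1 i) //= normrM ler_pM // normr_prod -exprMn.
have -> : (M * u) ^+ n.-1 = \prod_(j < n | j != i) (M * u).
  by rewrite prodr_const cardC1 card_ord.
by apply: ler_prod => j ji; rewrite normr_ge0 lj.
Qed.

(** Stated with x - t c since the values of p at e - c and at e - c - d are the
    ones that matter: the former is 0. *)
Lemma primitive_affine c x t : primitive_idempotent p e n c ->
  pevalOn p (x - t *: c) = (1 - t) * pevalOn p x + t * pevalOn p (x - c).
Proof.
move=> cP; have [C [d [d0 H]]] := primitive_small_det x cP.
(* line_poly p c x has at most n + 1 coefficients, and only its top two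
   survive. *)
have K0 j : (j < n.-1)%N -> (line_poly p c x)`_j = 0.
  apply: (coef_vanishing_order d0) => u u0 ud.
  by rewrite horner_line_poly; apply: H.
have sK : (size (line_poly p x c) <= 2)%N.
  apply/leq_sizeP => j j2; rewrite (line_poly_rev _ _ p_homog) coef_poly.
  by case: ifP => // jn; apply: K0; lia.
have KE u : pevalOn p (x - u *: c) = (line_poly p x c).[- u].
  by rewrite horner_line_poly scaleNr.
have := KE 0; have := KE 1; rewrite scale1r scale0r subr0 KE => -> ->.
by rewrite !(horner_coef_wide _ sK) !big_ord_recl !big_ord0 /=; ring.
Qed.

Lemma primitive_sqnorm c : primitive_idempotent p e n c ->
  sqnorm p e n c = 1.
Proof. exact: primitive_power_sum. Qed.

Lemma primitive_trace c : primitive_idempotent p e n c ->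
  trace p e n c = 1.
Proof. exact: (@primitive_power_sum c 0). Qed.

(** Being affine in c and in d, p (e - r c - s d) is determined by its values
    at r, s = 0, 1, and the primitivity of c and d leaves only the value D
    unknown.  The quadratic polynomial 1 - 2 w + D w^2 obtained on the diagonal
    is a product of real linear factors, so its discriminant 4 - 4 D is
    nonnegative, while sdot c d = 1 - D. *)
Lemma primitive_sdot_ge0 c d :
  primitive_idempotent p e n c -> primitive_idempotent p e n d ->
  0 <= sdot p e n c d.
Proof.
move=> cP dP.
have one x : primitive_idempotent p e n x -> pevalOn p (e - x) = 0.
  move=> xP; have := spectrum_eigenvalues hsys x 1; rewrite scale1r => ->.
  rewrite (bigD1 (Ordinal n_gt0)) //=.
  by rewrite primitive_ev // eqxx subrr mul0r mulr0.
pose D := pevalOn p (e - d - c) / p0 + 1.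
have biaff w : pevalOn p (e + w *: - (c + d)) = p0 * (1 - 2 * w + D * w ^+ 2).
  have -> : e + w *: - (c + d) = (e - w *: c) - w *: d.
    by rewrite scalerN scalerDr opprD addrA.
  rewrite (primitive_affine _ _ dP) (primitive_affine _ _ cP) one //.
  rewrite addrAC (primitive_affine _ _ cP) one //.
  by rewrite /D; field.
have lineE : line_poly p e (- (c + d)) = p0 *: (1 - 2 *: 'X + D *: 'X ^+ 2).
  by apply: poly_eq_off0 => w _; rewrite horner_line_poly biaff !hornerE.
have c1 : char_coef p e (c + d) 1 = - 2.
  by rewrite /char_coef lineE !(coefZ, coefD, coefN, coef1, coefX, coefXn) /=;
    field.
have c2 : char_coef p e (c + d) 2 = D.
  by rewrite /char_coef lineE !(coefZ, coefD, coefN, coef1, coefX, coefXn) /=;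
    field.
have [] := spectrum_power_sums hsys (spectrum_eigenvalues hsys (c + d)).
rewrite c1 c2 opprK => tr2 sq _.
have [i li] : exists i, ev (c + d) i != 0.
  apply/existsP; apply: contra_eqT tr2 => /existsPn H.
  rewrite big1 => [|i _]; first by rewrite eq_sym pnatr_eq0.
  by have := H i; rewrite negbK => /eqP.
have D1 : D <= 1.
  set a := ev (c + d) i in li.
  have : pevalOn p (a *: (e + a^-1 *: - (c + d))) = 0.
    rewrite scalerDr scalerA divff // scale1r.
    rewrite (spectrum_eigenvalues hsys) (bigD1 i) //=.
    by rewrite -/a subrr mul0r mulr0.
  rewrite (pevalOn_homog _ _ p_homog) biaff => /eqP.
  rewrite !mulf_eq0 expf_eq0 (negbTE li) andbF (negbTE p0_neq0) /= => /eqP Dw.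
  have w0 : 0 < a^-1 ^+ 2 by rewrite exprn_even_gt0 //= invr_eq0.
  (* At a root w of 1 - 2 w + D w^2, (1 - D) w^2 = (1 - w)^2. *)
  rewrite -subr_ge0 -(pmulr_lge0 _ w0).
  have -> : (1 - D) * a^-1 ^+ 2 = (1 - a^-1) ^+ 2.
    by move: Dw; set w := a^-1 => Dw; rewrite -[RHS]subr0 -Dw; ring.
  exact: sqr_ge0.
have : sqnorm p e n (c + d) = 2 + 2 * sdot p e n c d.
  rewrite -(sdot_self hsys) -[in LHS](scale1r c) (sdotDl hsys).
  rewrite !(sdotC hsys _ (_ + d)) !(sdotDl hsys) !(sdot_self hsys).
  by rewrite !primitive_sqnorm // (sdotC hsys d c); ring.
rewrite [LHS]sq => sdE; lra.
Qed.

End RankOne.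

(** * Jordan frames *)

Theorem theorem4p14 (R : realType) (V : vectType R) (n : nat)
    (p : polyOn V) (e : V) (k : nat) (c : 'I_k -> V)
    (hn : (2 <= n)%N)
    (hsys : hyperbolic_system p e n)
    (hc : forall i, hyperbolicity_cone p e n (c i)) :
  (jordan_frame p e n c -> orthonormal_family p e n c /\ k = n) /\
  (complete_system p e n ->
   (forall i, primitive_idempotent p e n (c i)) ->
   orthonormal_family p e n c -> k = n -> jordan_frame p e n c).
Proof.
have n0 : (0 < n)%N by apply: ltnW.
have trS x : trace p e n x = sdot p e n x e by rewrite sdot_unit.
split=> [[cP ce]|cpl cP [cO c1] kn].
  have kn : k = n.
    suff : k%:R = n%:R :> R by move/eqP; rewrite eqr_nat => /eqP.
    rewrite -(trace_unit hsys) trS -[X in sdot p e n X e]ce (sdot_suml hsys).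
    rewrite -[k in LHS]card_ord -sumr_const.
    by apply: eq_bigr => i _; rewrite -trS primitive_trace.
  split=> //; split=> [i j ij|i]; last first.
    by rewrite (sdot_self hsys) primitive_sqnorm.
  (* The values sdot (c l) (c i) sum to 1 and the one at l = i is 1, so the
     others, being nonnegative, vanish. *)
  have : \sum_(l | l != i) sdot p e n (c l) (c i) = 0.
    have := sdot_suml hsys c (c i); rewrite ce (sdotC hsys) -trS.
    rewrite primitive_trace // (bigD1 i) //= (sdot_self hsys).
    by rewrite primitive_sqnorm // -[LHS]addr0 => /addrI.
  move/eqP; rewrite psumr_eq0 => [/allP H|l _]; last exact: primitive_sdot_ge0.
  have := H j (mem_index_enum j); rewrite eq_sym ij /= => /eqP.
  by rewrite (sdotC hsys).
split=> //; apply/eqP; rewrite -subr_eq0; apply/eqP/cpl.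
set s := \sum_i c i.
have nE : n%:R = \sum_(i < k) 1 :> R by rewrite sumr_const card_ord kn.
have ss : sdot p e n s s = n%:R.
  rewrite (sdot_suml hsys) nE.
  apply: eq_bigr => i _; rewrite (sdotC hsys) (sdot_suml hsys) (bigD1 i) //=.
  by rewrite c1 big1 ?addr0 // => j ji; apply: cO.
have se : sdot p e n s e = n%:R.
  rewrite (sdot_suml hsys) nE.
  by apply: eq_bigr => i _; rewrite -trS primitive_trace.
have ee : sdot p e n e e = n%:R by rewrite -trS trace_unit.
have : sqnorm p e n (s - e) = 0.
  rewrite -(sdot_self hsys) addrC -scaleN1r (sdotDl hsys).
  rewrite !(sdotC hsys _ (_ + s)) !(sdotDl hsys) (sdotC hsys e s) ss se ee.
  by ring.
move/eqP; rewrite psumr_eq0 => [/allP H|i _]; last exact: sqr_ge0.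
apply/colP => i; rewrite [RHS]mxE; apply/eqP.
by have := H i (mem_index_enum i); rewrite /= sqrf_eq0.
Qed.
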